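(* Let $\mathbb{K}$ be a field of characteristic $p>0$. For every integer $n\geq 2$, $$1+\Bigl[\frac{p-1}{n}\Bigr]\leq s_n(\mathbb{K})\leq 5+\Bigl[\frac{p-1}{n}\Bigr].$$
   Context: $\mathbb{F}_p$ denotes the prime subfield of $\mathbb{K}$. An idempotent matrix is a matrix $Q\in \mathrm{M}_n(\mathbb{K})$ with $Q^2=Q$. For $n\geq 1$, $s_n(\mathbb{K})$ denotes the lowest integer $N$ such that every matrix $A\in \mathrm{M}_n(\mathbb{K})$ with $\operatorname{tr} A\in\mathbb{F}_p$ is a sum of $N$ idempotent matrices of $\mathrm{M}_n(\mathbb{K})$. $[x]$ denotes the greatest integer $k$ such that $k\leq x$. *)

(* Defs.v *)
From HB Require Import structures.
From mathcomp Require Import all_boot all_order all_algebra.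

Set Implicit Arguments.
Unset Strict Implicit.
Unset Printing Implicit Defensive.

Import GRing.Theory.
Local Open Scope ring_scope.

(* Membership in the prime subfield of K, the intersection of all subfields.
   Quantifying over decidable subfields only is harmless in positive
   characteristic, where the prime subfield is finite (prime_subfieldP). *)
Definition in_prime_subfield (K : fieldType) (a : K) : Prop :=
  forall S : {pred K}, divring_closed S -> a \in S.

Definition idempotent_mx (K : fieldType) (n : nat) (Q : 'M[K]_n) : Prop :=
  Q *m Q = Q.

Definition sum_of_idempotents (K : fieldType) (n N : nat) (A : 'M[K]_n) :
    Prop :=
  exists Q : 'I_N -> 'M[K]_n,
    (forall i, idempotent_mx (Q i)) /\ A = \sum_(i < N) Q i.

Definition idempotents_suffice (K : fieldType) (n N : nat) : Prop :=
  forall A : 'M[K]_n, in_prime_subfield (\tr A) -> sum_of_idempotents N A.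

(* is_s K n s: s_n(K) is well defined and equal to s. *)
Definition is_s (K : fieldType) (n s : nat) : Prop :=
  idempotents_suffice K n s /\
  (forall N : nat, idempotents_suffice K n N -> (s <= N)%N).

Lemma is_s_unique (K : fieldType) (n s t : nat) :
  is_s K n s -> is_s K n t -> s = t.
Proof.
by move=> [ss mins] [st mint]; apply/eqP; rewrite eqn_leq mins ?mint.
Qed.

Lemma prime_subfieldP (K : fieldType) (p : nat) (a : K) :
  p \in [pchar K] -> in_prime_subfield a <-> exists k : nat, a = k%:R.
Proof.
move=> pK; have p_pr := pcharf_prime pK; have p_gt0 := prime_gt0 p_pr.
pose S := [pred x : K | [exists k : 'I_p, x == (k : nat)%:R]].
have natS (k : nat) : k%:R \in S.
  apply/existsP; exists (Ordinal (ltn_pmod k p_gt0)).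
  by rewrite /= (GRing.natr_mod_pchar pK).
have SP x : x \in S -> exists k : nat, x = k%:R.
  by case/existsP=> k /eqP ->; exists k.
split=> [aP|[k ->] S' [S1 SB _]]; last first.
  have S0 : 0 \in S' by rewrite -(subrr 1) SB.
  elim: k => // k IHk.
  have N1 : - 1 \in S' by rewrite -(sub0r 1) SB.
  by rewrite -natr1 -[X in _ + X]opprK SB.
apply/SP/aP; split=> [|_ _ /SP[i ->] /SP[j ->]|_ _ /SP[i ->] /SP[j ->]].
- exact: (natS 1%N).
- suff -> : i%:R - j%:R = (i + j * p.-1)%:R :> K by [].
  apply/eqP; rewrite subr_eq -natrD -addnA -mulnSr prednK // natrD natrM.
  by rewrite (pcharf0 pK) mulr0 addr0.
- have [->|j0] := eqVneq (j%:R : K) 0; first by rewrite invr0 mulr0 (natS 0).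
  suff -> : (j%:R : K)^-1 = j%:R ^+ p.-2 by rewrite -natrX -natrM.
  apply: (mulIf j0); rewrite mulVf // -exprSr.
  apply: (mulIf j0); rewrite mul1r -exprSr.
  have -> : p.-2.+2 = p by case: (p) (prime_gt1 p_pr) => [|[]].
  by rewrite -(pFrobenius_autE pK) pFrobenius_aut_nat.
Qed.

(* Main.v *)
Require Import Defs.
From mathcomp Require Import all_boot all_order all_algebra.
From mathcomp Require Import boolp ring.
Import GRing.Theory.
Local Open Scope ring_scope.

(** Upper bound.  Let [e_0, ..., e_n] be the standard basis, and consider the
    spans of the [e_i] with [i] even, of the [e_i] with [i] odd, of the
    [e_i + e_{i+1}] with [i] even, and of the [e_i + e_{i+1}] with [i] odd.
    Only scalar matrices stabilize these four subspaces, and their dimensions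
    add up to [2n+1]; by duality every matrix of trace [2n+1] is the sum of
    four idempotents having these subspaces as images.  Concretely, the last
    two idempotents are sums of rank one matrices [(e_i + e_{i+1}) phi_i], and
    the first two add up to the identity plus an arbitrary matrix vanishing at
    the [(i, j)] with [i = j] mod 2.  The remaining conditions on the
    coefficients of the [phi_i] form independent chains along the diagonals;
    only the main diagonal is constrained at both ends, which is the trace
    condition.  A matrix with trace in the prime field is brought to this case
    by subtracting [1 + (p-1)/n] diagonal idempotents, whose total rank can be
    any number in [0, p-1].

    Lower bound.  The ranks in a decomposition of [- E_00] add up to [-1] mod
    [p]; if there are at most [(p-1)/n] summands, they are all equal to the
    identity, but [- E_00] is not scalar. *)

Lemma sum_of_idempotents_cat {K : fieldType} {n M N : nat} {A B : 'M[K]_n} :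
  sum_of_idempotents M A -> sum_of_idempotents N B ->
  sum_of_idempotents (M + N) (A + B).
Proof.
move=> [P [idP ->]] [Q [idQ ->]].
exists (fun i => match split i with inl j => P j | inr k => Q k end).
split=> [i|]; first by case: (split i).
rewrite big_split_ord; congr (_ + _); apply: eq_bigr => i _.
  by rewrite -[lshift _ _]/(unsplit (inl i)) unsplitK.
by rewrite -[rshift _ _]/(unsplit (inr i)) unsplitK.
Qed.

Lemma sum_of_idempotents1 {K : fieldType} {n : nat} {Q : 'M[K]_n} :
  idempotent_mx Q -> sum_of_idempotents 1 Q.
Proof. by move=> idQ; exists (fun=> Q); rewrite big_ord1. Qed.

(** Greedy: one [pid_mx] takes [minn s n] of the trace and leaves the truncated [s - n] to the
    induction. *)
Lemma sum_of_idempotents_trace (K : fieldType) (n N s : nat) :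
  (s <= N * n)%N ->
  exists A : 'M[K]_n, sum_of_idempotents N A /\ \tr A = s%:R.
Proof.
elim: N s => [|N IHN] s les.
  have -> : s = 0%N by case: s les.
  exists 0; split; last by rewrite mxtrace0.
  by exists (fun=> 0); rewrite big_ord0; split=> // -[].
have [A [sumA trA]] : exists A : 'M[K]_n,
    sum_of_idempotents N A /\ \tr A = (s - n)%:R.
  by apply: IHN; rewrite leq_subLR -mulSn.
exists (pid_mx (minn s n) + A); split.
  rewrite -add1n; apply: sum_of_idempotents_cat sumA.
  by apply: sum_of_idempotents1; apply: pid_mx_id; rewrite geq_minr.
have tr_pid : \tr (pid_mx (minn s n) : 'M[K]_n) = (minn s n)%:R.
  rewrite /mxtrace (eq_bigr (fun i : 'I_n => (i < minn s n)%:R)); last first.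
    by move=> i _; rewrite mxE eqxx.
  rewrite -natr_sum; congr _%:R.
  rewrite (eq_bigr (fun i : 'I_n => if (i < minn s n)%N then 1 else 0)%N).
    rewrite -big_mkcond (big_ord_narrow (geq_minr s n)) sum1_card card_ord //.
  by move=> i _; case: ifP.
by rewrite mxtraceD tr_pid trA -natrD minnE subnK ?leq_subr.
Qed.

(** Cancelling the full-rank factors of [Q = C R] in [Q Q = Q] leaves [R C = 1], of size the
    rank. *)
Lemma trace_idempotent (K : fieldType) (n : nat) (Q : 'M[K]_n) :
  idempotent_mx Q -> \tr Q = (\rank Q)%:R.
Proof.
move=> idQ; rewrite -{1}(mulmx_base Q) mxtrace_mulC.
suff -> : row_base Q *m col_base Q = 1%:M by rewrite mxtrace1.
apply: (row_full_inj (col_base_full Q)).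
apply: (row_free_inj (row_base_free Q)).
rewrite /= mulmx1 mulmxA mulmx_base -mulmxA mulmx_base.
exact: idQ.
Qed.

(* The chains: [b] is started at row 0 on and above the main diagonal and is
   forced to end at 0 in row [n] below it; on the main diagonal the hypothesis
   on [c] reconciles both boundary conditions. *)
Lemma diagonal_recurrence (K : fieldType) (n : nat) (c : nat -> nat -> K) :
  \sum_(0 <= i < n.+1) c i i = n%:R ->
  exists b : nat -> nat -> K,
  [/\ forall j, b 0%N j = c 0%N j,
      forall j, (j <= n)%N -> b n j = 0 &
      forall i j, (i < n)%N ->
        b i.+1 j.+1 = b i j + c i.+1 j.+1 - (i == j)%:R].
Proof.
move=> trc.
exists (fun i j => if (i <= j)%N
  then \sum_(0 <= l < i.+1) c l (l + (j - i))%N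
       - (if i == j then i else 0%N)%:R
  else - \sum_(i.+1 <= l < n.+1) c l (l - (i - j))%N).
split=> [j|j|i j lt_in].
- by rewrite big_nat1 subn0 add0n if_same subr0.
- rewrite leq_eqVlt => /predU1P[->|lt_jn]; last first.
    by rewrite leqNgt lt_jn /= big_geq ?oppr0.
  rewrite leqnn eqxx subnn (eq_bigr (fun l => c l l)) ?trc ?subrr // => l _.
  by rewrite addn0.
rewrite ltnS !subSS eqSS; case: leqP => [le_ij|lt_ji].
  rewrite big_nat_recr //= addSn subnKC //.
  case: eqP => _; last by rewrite !subr0.
  by rewrite -[i.+1%:R]natr1 /=; ring.
rewrite [in RHS]big_ltn // (subSn (leq_subr _ _)) subKn ?(ltnW lt_ji) //.
by rewrite (gtn_eqF lt_ji) /=; ring.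
Qed.

Lemma four_idempotents (K : fieldType) (n : nat) (B : 'M[K]_n.+1) :
  \tr B = (n.+1 + n)%:R -> sum_of_idempotents 4 B.
Proof.
move=> trB.
(* The first two idempotents supply the identity; [U *m Phi] must supply [B - 1] where [i = j] mod
   2. *)
pose c i j : K := (B - 1%:M) (inord i) (inord j).
have [|b [b0 bn bS]] := @diagonal_recurrence K n c.
  rewrite big_mkord (eq_bigr (fun i => (B - 1%:M) i i)); last first.
    by move=> i _; rewrite /c inord_val.
  rewrite -[LHS]/(\tr (B - 1%:M)) raddfB /= mxtrace1 trB natrD.
  by rewrite addrC addKr.
(* [a i j] is the value of [phi_i] at [e_j]. *)
pose a i j : K := if odd (i + j)
  then (if j is j'.+1 then (i == j')%:R - b i j' else c i.+1 0%N - b i.+1 0%N)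
  else b i j.
(* Index [n] is padding that keeps the matrices square. *)
pose Phi : 'M[K]_n.+1 := \matrix_(i, j) (if (i < n)%N then a i j else 0).
pose U : 'M[K]_n.+1 := \matrix_(m, i)
  (if (i < n)%N then (m == i)%:R + (m == i.+1 :> nat)%:R else 0).
pose D e : 'M[K]_n.+1 := diag_mx (\row_i (odd i == e)%:R).
have DD e : D e *m D e = D e.
  rewrite mulmx_diag; congr diag_mx; apply/rowP => i; rewrite !mxE.
  by case: eqP => _; rewrite ?mulr1 ?mulr0.
have DE : D false + D true = 1%:M.
  rewrite -raddfD /= -diag_const_mx; congr diag_mx; apply/rowP => i.
  by rewrite !mxE; case: (odd i); rewrite ?addr0 ?add0r.
have DxD e (X : 'M[K]_n.+1) i j : (D e *m X *m D e) i j =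
    if (odd i == e) && (odd j == e) then X i j else 0.
  rewrite mul_mx_diag mxE mul_diag_mx !mxE.
  by case: (odd i == e); case: (odd j == e);
    rewrite /= ?mul1r ?mulr1 ?mul0r ?mulr0.
have delta_sum (F : 'I_n.+1 -> K) (k : 'I_n.+1) :
    \sum_i (k == i)%:R * F i = F k.
  rewrite (bigD1 k) //= eqxx mul1r big1 ?addr0 // => i.
  by rewrite eq_sym => /negbTE->; rewrite mul0r.
(* For [i = j] mod 2 the odd case of [a] gives [a i j + a i j.+1 = (i == j)%:R], a duality between
   the phi_i and the e_j + e_{j+1} of one parity. *)
have PhiU e : D e *m (Phi *m U) *m D e *m Phi = D e *m Phi.
  pose E : 'M[K]_n.+1 := diag_mx (\row_i (i < n)%N%:R).
  have -> : D e *m (Phi *m U) *m D e = D e *m E *m D e.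
    apply/matrixP => i j; rewrite !DxD.
    case: andP => // -[/eqP odd_i /eqP odd_j].
    rewrite !mxE; have [lt_in|ge_in] := ltnP i n; last first.
      by rewrite mul0rn big1 // => k _; rewrite mxE ltnNge ge_in mul0r.
    have [lt_jn|ge_jn] := ltnP j n; last first.
      rewrite big1 => [|k _]; last by rewrite [U _ _]mxE ltnNge ge_jn mulr0.
      by case: eqP => // eq_ij; rewrite -eq_ij leqNgt lt_in in ge_jn.
    have lt_j1 : (j.+1 < n.+1)%N by [].
    rewrite (eq_bigr (fun k => (j == k)%:R * Phi i k
        + (Ordinal lt_j1 == k)%:R * Phi i k)); last first.
      move=> k _; rewrite [U _ _]mxE lt_jn -mulrDl mulrC.
      by congr ((_%:R + _%:R) * _); rewrite eq_sym.
    rewrite big_split /= !delta_sum !mxE lt_in /a /= addnS /= oddD odd_i odd_j.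
    by rewrite addbb /= addrC subrK.
  rewrite -(mulmxA _ E) [E *m _]diag_mxC mulmxA DD -mulmxA.
  congr (_ *m _); apply/matrixP => i j; rewrite mul_diag_mx !mxE.
  by case: (i < n)%N; rewrite ?mul1r ?mul0r.
(* Row [n] of [Phi] is zero, which is the end condition on [b]. *)
have PhiE (i j : 'I_n.+1) : ~~ odd (i + j) -> Phi i j = b i j.
  rewrite mxE /a => /negbTE->; case: ltnP => // le_ni.
  have -> : i = n :> nat by apply/eqP; rewrite eqn_leq leq_ord.
  by rewrite bn ?leq_ord.
(* Row [i] of [U *m Phi] is phi_{i-1} + phi_i, or phi_0 if [i = 0]; [b] was built to make this
   [c i j] at equal parity. *)
have UPhi e : D e *m (U *m Phi) *m D e = D e *m (B - 1%:M) *m D e.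
  apply/matrixP => i j; rewrite !DxD.
  case: andP => // -[/eqP odd_i /eqP odd_j].
  have ev_ij : ~~ odd (i + j) by rewrite oddD odd_i odd_j addbb.
  have -> : (B - 1%:M) i j = c i j by rewrite /c !inord_val.
  rewrite mxE (eq_bigr (fun k => (i == k)%:R * Phi k j
      + (i == k.+1 :> nat)%:R * Phi k j)); last first.
    by move=> k _; rewrite -mulrDl !mxE; case: (k < n)%N; rewrite ?mulr0.
  rewrite big_split /= delta_sum PhiE //.
  case: i ev_ij {odd_i} => -[|m] /= lt_m ev_mj.
    by rewrite b0 big1 ?addr0 // => k _; rewrite mul0r.
  rewrite (eq_bigr (fun k => (Ordinal (ltnW lt_m) == k)%:R * Phi k j)) //.
  rewrite delta_sum mxE /= -ltnS lt_m /a /=.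
  move: ev_mj; rewrite negbK => ->.
  case: (j : nat) => [|j']; first by rewrite addrC subrK.
  by rewrite bS //; ring.
pose X := B - 1%:M - U *m Phi.
have DXD e : D e *m X *m D e = 0.
  by rewrite mulmxBr mulmxBl UPhi subrr.
have idX e : idempotent_mx (D e + D e *m X).
  rewrite /idempotent_mx mulmxDr !mulmxDl !mulmxA DD DXD.
  by rewrite addr0 mul0mx addr0.
have idU e : idempotent_mx (U *m D e *m Phi).
  by rewrite /idempotent_mx -[RHS]mulmxA -(PhiU e) !mulmxA.
have -> : B = (D false + D false *m X) + (D true + D true *m X)
    + (U *m D false *m Phi) + (U *m D true *m Phi).
  rewrite -addrA -mulmxDl -mulmxDr DE mulmx1 addrACA -mulmxDl DE mul1mx.
  by rewrite -addrA subrK addrC subrK.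
rewrite -[4%N]/(1 + 1 + 1 + 1)%N.
by do !apply: sum_of_idempotents_cat; apply: sum_of_idempotents1.
Qed.

Lemma idempotents_suffice_lower (K : fieldType) (p n N : nat) :
  p \in [pchar K] -> (2 <= n)%N -> idempotents_suffice K n N ->
  ((p - 1) %/ n < N)%N.
Proof.
move=> pK; case: n => [|[|n]] // _ sufN; have p_pr := pcharf_prime pK.
rewrite ltnNge leq_divRL //; apply/negP=> leN.
pose A : 'M[K]_n.+2 := - delta_mx 0 0.
have trA : \tr A = - 1.
  rewrite raddfN /= /mxtrace (bigD1 0) //= big1 ?mxE ?addr0 // => i.
  by rewrite mxE => /negbTE->.
have [|Q [idQ defA]] := sufN A.
  rewrite trA (prime_subfieldP _ pK); exists (p - 1)%N.
  by rewrite natrB ?prime_gt0 // (pcharf0 pK) sub0r.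
have dvd_p : (p %| (\sum_(i < N) \rank (Q i)).+1)%N.
  rewrite (dvdn_pcharf pK) -natr1 natr_sum.
  rewrite -(eq_bigr _ (fun i _ => trace_idempotent _ _ _ (idQ i))).
  by move: trA; rewrite defA raddf_sum /= => ->; rewrite addNr.
(* One smaller rank would bound a positive multiple of [p] by [N * n.+2 <= p - 1]. *)
have rankQ i : \rank (Q i) = n.+2.
  apply/eqP; rewrite eqn_leq rank_leq_row leqNgt; apply/negP=> ltQi.
  have /(leq_trans (dvdn_leq (ltn0Sn _) dvd_p)) :
      ((\sum_(i < N) \rank (Q i)).+1 <= N * n.+2)%N.
    have -> : (N * n.+2 = \sum_(j < N) n.+2)%N
      by rewrite sum_nat_const card_ord.
    rewrite (bigD1 i) //= [leqRHS](bigD1 i) //=.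
    by rewrite -addSn leq_add // leq_sum // => j _; apply: rank_leq_row.
  by move/leq_trans/(_ leN); rewrite subn1 leqNgt ltn_predL prime_gt0.
have Q1 i : Q i = 1%:M.
  have Qu : Q i \in unitmx by rewrite -row_full_unit /row_full rankQ.
  by apply: (can_inj (mulKmx Qu)); rewrite idQ mulmx1.
have defA1 : A = (N%:R)%:M.
  by rewrite defA (eq_bigr _ (fun i _ => Q1 i)) sumr_const card_ord -raddfMn.
(* Size at least 2 provides a second diagonal entry, 0 against -1. *)
have := congr1 (fun A : 'M_n.+2 => A 1 1) defA1.
have := congr1 (fun A : 'M_n.+2 => A 0 0) defA1.
rewrite !mxE /= => <- /eqP.
by rewrite oppr0 eq_sym oppr_eq0 oner_eq0.
Qed.

Lemma idempotents_suffice_upper (K : fieldType) (p n : nat) :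
  p \in [pchar K] -> (0 < n)%N -> idempotents_suffice K n (5 + (p - 1) %/ n).
Proof.
move=> pK; case: n => // n _ A /(prime_subfieldP _ pK)[k trA].
have p_gt0 := prime_gt0 (pcharf_prime pK).
(* The residue of [k - (n.+1 + n)], with [p.-1] for -1, so that [A - D] has the trace required by
   [four_idempotents]. *)
pose s := ((k + (n.+1 + n) * p.-1) %% p)%N.
have [|D [sumD trD]] := sum_of_idempotents_trace K n.+1 ((p - 1) %/ n.+1).+1 s.
  rewrite ltnW // (leq_ltn_trans _ (ltn_ceil (p - 1) (ltn0Sn n))) //.
  by rewrite subn1 -ltnS prednK ?ltn_mod.
have -> : (5 + (p - 1) %/ n.+1 = 4 + ((p - 1) %/ n.+1).+1)%N by rewrite addnS.
rewrite -(subrK D A); apply: sum_of_idempotents_cat sumD.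
apply: four_idempotents; rewrite raddfB /= trA trD (GRing.natr_mod_pchar pK).
apply/eqP; rewrite subr_eq -natrD addnCA -mulnS prednK // natrD natrM.
by rewrite (pcharf0 pK) mulr0 addr0.
Qed.

Theorem corollary8 (K : fieldType) (p : nat) (hp : p \in [pchar K])
    (n : nat) (hn : (2 <= n)%N) :
  exists s : nat, is_s K n s /\
    (1 + (p - 1) %/ n <= s)%N /\ (s <= 5 + (p - 1) %/ n)%N.
Proof.
have suf := idempotents_suffice_upper _ _ _ hp (ltnW hn).
have exN : exists N, `[< idempotents_suffice K n N >].
  by exists (5 + (p - 1) %/ n)%N; apply/asboolP.
case: (ex_minnP exN) => s /asboolP sufs mins; exists s.
split; first by split=> // N sufN; apply/mins/asboolP.
split; last exact/mins/asboolP.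
exact: idempotents_suffice_lower hp hn sufs.
Qed.
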